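(* The sum $C_n(\nu)=\sum_{l=1}^{n-1}\cos\frac{2\pi\nu l}{n}\cdot\csc\frac{\pi l}{n}$, where $n$ and $\nu$ are integers with $1<\nu<n$, admits the following cosecant-free asymptotic expansion: $$\sum_{l=1}^{n-1}\cos\frac{2\pi\nu l}{n}\cdot\csc\frac{\pi l}{n}=-\frac{2n}{\pi}\ln\!\left(2\sin\frac{\pi\nu}{n}\right)+n g(\nu)-\frac{\pi}{36n}-\frac{(120\nu^2-7)\pi^3}{21600\,n^3}+o(n^{-3}),\qquad n\to\infty,$$ where $$g(\nu)=-\frac1\pi\left\{4H_{2\nu}-2H_\nu-2\ln\nu-4\ln2-2\gamma\right\}.$$ It may also be used as an approximation for $C_n(\nu)$, whose error tends to zero as $n\to\infty$.
   Context: $H_m=1+\frac12+\cdots+\frac1m$ is the $m$-th harmonic number and $\gamma=\lim_{m\to\infty}(H_m-\ln m)$ is Euler's constant. *)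

(* Defs.v *)
From Stdlib Require Import Reals.
From Coquelicot Require Import Coquelicot.

Local Open Scope R_scope.

Definition csc (x : R) : R := / sin x.

Definition harmonic (m : nat) : R := sum_n_m (fun k : nat => / INR k) 1 m.

(* The junk value of [ln] at 0 only affects the term m = 0. *)
Definition euler_gamma : R :=
  real (Lim_seq (fun m : nat => harmonic m - ln (INR m))).

Definition cosec_sum (n nu : nat) : R :=
  sum_n_m
    (fun l : nat =>
       cos (2 * PI * INR nu * INR l / INR n) * csc (PI * INR l / INR n))
    1 (n - 1).

Definition g (nu : nat) : R :=
  - (1 / PI) *
  (4 * harmonic (2 * nu) - 2 * harmonic nu - 2 * ln (INR nu) - 4 * ln 2
   - 2 * euler_gamma).

Definition cosec_free_approx (n nu : nat) : R :=
  - (2 * INR n / PI) * ln (2 * sin (PI * INR nu / INR n))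
  + INR n * g nu
  - PI / (36 * INR n)
  - (120 * INR nu ^ 2 - 7) * PI ^ 3 / (21600 * INR n ^ 3).

(* Main.v *)
Require Import Defs.
From Stdlib Require Import Reals Factorial Lra Lia.
From Coquelicot Require Import Coquelicot.

Local Open Scope R_scope.

(* With k = pi/(2n), the identity csc x = cot(x/2) - cot x and the antisymmetry of cot under
   x -> pi - x give C_n(0) = sum_{l=1}^n cot(lk), and summing sines gives
   C_n(nu) = C_n(0) - 2 sum_{j=1}^nu cot((2j-1)k).  Write cot x = 1/x + L'(x) with
   L(x) = ln(sin x / x), smooth on [0, pi).  The polar part of C_n(0) is H_n / k, expanded by
   Euler-Maclaurin for 1/x; the regular part is a Riemann sum of L' on [0, pi/2], expanded by
   Euler-Maclaurin with exact endpoint values; the finite sum and ln sin(pi nu/n) are expanded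
   at 0.  All errors are O(n^-4). *)

(** * Finite sums *)

(** The pole of the cotangent at 0 forces the splitting: Euler-Maclaurin needs derivatives that stay
    bounded up to the endpoints. Each half alone produces terms in 1/(pi n) and 1/(pi n^3); those of
    H_n cancel against the share of -ln x in the derivatives of L at pi/2. What survives of the
    differences of L'' and L'''' between 0 and pi/2 is -pi/(36n) and 7 pi^3/(21600 n^3). The powers
    of nu in the finite sum cancel against those of ln sin(pi nu/n), except for -2 nu^2 k^3/45,
    which is the nu^2 term of the theorem. The combination 4 H_{2nu} - 2 H_nu in g is four times the
    sum of 1/(2j-1) for j <= nu. *)

Lemma sum_n_m_empty (u : nat -> R) (a m : nat) : (m < a)%nat -> sum_n_m u a m = 0.
Proof. exact (sum_n_m_zero u a m). Qed.

(** Stated over R, so that rewriting produces the addition that [ring] and [lra] recognise instead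
    of the abstract [plus]. *)
Lemma sum_n_m_snoc (u : nat -> R) (a m : nat) :
  (a <= S m)%nat -> sum_n_m u a (S m) = sum_n_m u a m + u (S m).
Proof. exact (sum_n_Sm u a m). Qed.

Lemma sum_n_m_R_ext (u v : nat -> R) (a m : nat) :
  (forall l, (a <= l <= m)%nat -> u l = v l) -> sum_n_m u a m = sum_n_m v a m.
Proof. exact (sum_n_m_ext_loc u v a m). Qed.

Lemma sum_n_m_lin (u v : nat -> R) (c d : R) (a m : nat) :
  sum_n_m (fun l => c * u l + d * v l) a m = c * sum_n_m u a m + d * sum_n_m v a m.
Proof.
  rewrite <- (sum_n_m_mult_l (K := R_Ring) c u), <- (sum_n_m_mult_l (K := R_Ring) d v).
  symmetry. exact (eq_sym (sum_n_m_plus (G := R_AbelianMonoid) _ _ a m)).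
Qed.

(** Serves the reflection l -> n - l. The induction is generalised over [u], since peeling the last
    term on one side and the first on the other shifts [u] by one. *)
Lemma sum_n_m_rev (u : nat -> R) (m : nat) :
  sum_n_m (fun l => u (S m - l)%nat) 1 m = sum_n_m u 1 m.
Proof.
  revert u; induction m as [|m IH]; intros u.
  - rewrite !sum_n_m_empty by lia; reflexivity.
  - rewrite sum_n_m_snoc by lia.
    rewrite (sum_Sn_m u 1 (S m)) by lia; rewrite <- (sum_n_m_S u 1 m).
    rewrite <- (IH (fun l => u (S l))).
    replace (S (S m) - S m)%nat with 1%nat by lia.
    rewrite Rplus_comm; apply (f_equal (Rplus (u 1%nat))).
    apply sum_n_m_R_ext; intros l Hl; f_equal; lia.
Qed.

Lemma sum_n_m_abs_le (u : nat -> R) (B : R) (m : nat) :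
  (forall l, (1 <= l <= m)%nat -> Rabs (u l) <= B) ->
  Rabs (sum_n_m u 1 m) <= INR m * B.
Proof.
  induction m as [|m IH]; intros H.
  - rewrite sum_n_m_empty by lia; simpl; rewrite Rabs_R0; lra.
  - rewrite sum_n_m_snoc, S_INR by lia.
    eapply Rle_trans; [apply Rabs_triang|].
    assert (H1 := IH ltac:(intros; apply H; lia)); assert (H2 := H (S m) ltac:(lia)); lra.
Qed.

(** * The derivatives of ln (sin x / x) *)

(** The library defines [sin x] as x times a series in x^2 with coefficients [sin_n]; interleaving
    zeros turns that series into a power series in x. *)
Definition sinc_coef (n : nat) : R :=
  if Nat.even n then sin_n (Nat.div2 n) else 0.

(* [sinc_d i] is the [i]-th derivative of [sin x / x], extended to [x = 0]. *)
Definition sinc_d (i : nat) (x : R) : R :=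
  PSeries (Nat.iter i PS_derive sinc_coef) x.

Lemma sinc_pseries (x : R) :
  exists l, is_pseries sinc_coef x l /\ sin x = x * l.
Proof.
  unfold sin; destruct (exist_sin (Rsqr x)) as [l Hl].
  (* The shape required by [is_pseries_odd_even]: even part plus x times the odd part, which is
     0. *)
  exists (l + x * 0); split; [|ring].
  apply is_pseries_odd_even.
  - apply is_pseries_R.
    apply (is_series_ext (fun n => sin_n n * (Rsqr x) ^ n)).
    + intros n; unfold sinc_coef.
      rewrite Nat.even_mul, Nat.div2_double; simpl Nat.even; cbv iota.
      rewrite Rsqr_pow2; reflexivity.
    + apply is_series_Reals; exact Hl.
  - apply is_pseries_R.
    apply (is_series_ext (fun n => 0)).
    + intros n; unfold sinc_coef.
      rewrite Nat.even_add, Nat.even_mul; simpl; ring.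
    + apply is_series_Reals; intros eps Heps; exists 0%nat; intros n _.
      rewrite sum_eq_R0 by reflexivity.
      unfold Rdist; rewrite Rminus_diag, Rabs_R0; exact Heps.
Qed.

(** Outside the disk of convergence the terms do not tend to 0, whereas this series converges at
    every x. Differentiation preserves the radius. *)
Lemma sinc_radius (i : nat) :
  CV_radius (Nat.iter i PS_derive sinc_coef) = p_infty.
Proof.
  induction i as [|i IH]; simpl.
  2: rewrite CV_radius_derive; exact IH.
  assert (H : forall x, 0 < x -> ~ Rbar_lt (CV_radius sinc_coef) x).
  { intros x Hx Hlt.
    apply (CV_disk_outside sinc_coef x).
    - rewrite Rabs_pos_eq by lra; exact Hlt.
    - destruct (sinc_pseries x) as [l [Hl _]].
      apply is_pseries_R in Hl.
      apply ex_series_lim_0; exists l; exact Hl. }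
  assert (H0 := CV_radius_ge_0 sinc_coef).
  destruct (CV_radius sinc_coef) as [r| |]; simpl in *; try easy.
  exfalso; apply (H (r + 1)); lra.
Qed.

Lemma sinc_d_derive (i : nat) (x : R) :
  is_derive (sinc_d i) x (sinc_d (S i) x).
Proof.
  apply is_derive_PSeries; rewrite sinc_radius; exact I.
Qed.

Lemma sin_sinc (x : R) : x * sinc_d 0 x = sin x.
Proof.
  destruct (sinc_pseries x) as [l [Hl ->]].
  f_equal; exact (is_pseries_unique _ _ _ Hl).
Qed.

Fixpoint sin_d (i : nat) (x : R) : R :=
  match i with
  | 0%nat => sin x
  | 1%nat => cos x
  | S (S j) => - sin_d j x
  end.

Lemma sin_d_derive (i : nat) (x : R) : is_derive (sin_d i) x (sin_d (S i) x).
Proof.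
  (* Two consecutive orders are proved together because [sin_d] recurses in steps of two. *)
  assert (H : is_derive (sin_d i) x (sin_d (S i) x) /\
              is_derive (sin_d (S i)) x (sin_d (S (S i)) x)); [|exact (proj1 H)].
  induction i as [|i [H1 H2]].
  - split; simpl; [apply is_derive_sin | apply is_derive_cos].
  - split; [exact H2|].
    exact (is_derive_opp (sin_d i) x _ H1).
Qed.

Lemma mul_sinc_d_derive (i : nat) (x : R) :
  is_derive (fun x => x * sinc_d i x) x (sinc_d i x + x * sinc_d (S i) x).
Proof.
  assert (D := sinc_d_derive i x).
  auto_derive; [eexists; exact D|].
  rewrite (is_derive_unique (fun y : R => sinc_d i y) _ _ D); ring.
Qed.

(* Leibniz' rule applied to [x * sinc x = sin x]. *)
Lemma sinc_d_rel (i : nat) (x : R) :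
  x * sinc_d (S i) x + INR (S i) * sinc_d i x = sin_d (S i) x.
Proof.
  revert x; induction i as [|i IH]; intros x.
  - assert (H1 := mul_sinc_d_derive 0 x).
    apply (is_derive_ext _ sin) in H1; [|apply sin_sinc].
    apply is_derive_unique in H1.
    rewrite (is_derive_unique _ _ _ (is_derive_sin x)) in H1.
    simpl; lra.
  - assert (H1 : is_derive (fun x => x * sinc_d (S i) x + INR (S i) * sinc_d i x) x
      ((sinc_d (S i) x + x * sinc_d (S (S i)) x) + INR (S i) * sinc_d (S i) x)).
    { apply (is_derive_plus (fun x => x * sinc_d (S i) x)).
      - apply mul_sinc_d_derive.
      - apply (is_derive_scal (sinc_d i)); apply sinc_d_derive. }
    apply (is_derive_ext _ (sin_d (S i))) in H1; [|apply IH].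
    apply is_derive_unique in H1.
    rewrite (is_derive_unique _ _ _ (sin_d_derive (S i) x)) in H1.
    rewrite (S_INR (S i)); lra.
Qed.

Lemma sinc_pos (x : R) : 0 <= x < PI -> 0 < sinc_d 0 x.
Proof.
  intros [[H0|<-] HP].
  - assert (H := sin_gt_0 x H0 HP); rewrite <- sin_sinc in H.
    apply (Rmult_lt_reg_l x); lra.
  (* At 0 the relation x * sinc = sin gives nothing; its derivative gives [sinc_d 0 0] = cos 0 =
     1. *)
  - assert (H := sinc_d_rel 0 0); simpl in H; rewrite cos_0 in H; lra.
Qed.

Definition sinc_r (i : nat) (x : R) : R := sinc_d i x / sinc_d 0 x.

(** By this formula the polynomials in the [sinc_r i] are closed under differentiation, so the
    derivatives of the logarithm can be checked by [ring]. *)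
Lemma sinc_r_derive (i : nat) (x : R) :
  0 < sinc_d 0 x ->
  is_derive (sinc_r i) x (sinc_r (S i) x - sinc_r i x * sinc_r 1 x).
Proof.
  intros Hx.
  replace (sinc_r (S i) x - sinc_r i x * sinc_r 1 x)
    with ((sinc_d (S i) x * sinc_d 0 x - sinc_d i x * sinc_d 1 x) / sinc_d 0 x ^ 2)
    by (unfold sinc_r; field; lra).
  apply (is_derive_div (sinc_d i) (sinc_d 0)); try apply sinc_d_derive; lra.
Qed.

(* The iterated derivatives of [ln (sin x / x)]: cumulants in terms of the moments [sinc_r]. *)
Definition lnsinc_d (i : nat) (x : R) : R :=
  let r1 := sinc_r 1 x in let r2 := sinc_r 2 x in let r3 := sinc_r 3 x in
  let r4 := sinc_r 4 x in let r5 := sinc_r 5 x in let r6 := sinc_r 6 x in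
  match i with
  | 0%nat => ln (sinc_d 0 x)
  | 1%nat => r1
  | 2%nat => r2 - r1 ^ 2
  | 3%nat => r3 - 3 * r2 * r1 + 2 * r1 ^ 3
  | 4%nat => r4 - 4 * r3 * r1 - 3 * r2 ^ 2 + 12 * r2 * r1 ^ 2 - 6 * r1 ^ 4
  | 5%nat => r5 - 5 * r4 * r1 - 10 * r3 * r2 + 20 * r3 * r1 ^ 2
         + 30 * r2 ^ 2 * r1 - 60 * r2 * r1 ^ 3 + 24 * r1 ^ 5
  | 6%nat => r6 - 6 * r5 * r1 - 15 * r4 * r2 + 30 * r4 * r1 ^ 2
         - 10 * r3 ^ 2 + 120 * r3 * r2 * r1 - 120 * r3 * r1 ^ 3
         + 30 * r2 ^ 3 - 270 * r2 ^ 2 * r1 ^ 2 + 360 * r2 * r1 ^ 4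
         - 120 * r1 ^ 6
  | _ => 0
  end.

Lemma lnsinc_d_derive (i : nat) (x : R) :
  (i < 6)%nat -> 0 <= x < PI ->
  is_derive (lnsinc_d i) x (lnsinc_d (S i) x).
Proof.
  intros Hi Hx; apply sinc_pos in Hx.
  assert (D := fun j => sinc_r_derive j x Hx).
  assert (E : forall j, ex_derive (sinc_r j) x) by (intros j; eexists; apply D).
  assert (V : forall j, Derive (fun y : R => sinc_r j y) x = sinc_r (S j) x - sinc_r j x * sinc_r 1 x)
    by (intros j; apply is_derive_unique, D).
  destruct i as [|[|[|[|[|[|i]]]]]]; [..|lia]; unfold lnsinc_d; cbv zeta.
  1: { assert (D0 := sinc_d_derive 0 x). auto_derive.
       - split; [eexists; exact D0 | split; [exact Hx | exact I]].
       - rewrite (is_derive_unique (fun y : R => sinc_d 0 y) _ _ D0); unfold sinc_r; field; lra. }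
  all: auto_derive; [repeat split; apply E|].
  all: rewrite !V; ring.
Qed.


(** * Cotangent and logarithm of the sine; values at 0 and pi/2 *)

Definition cotan (x : R) : R := cos x / sin x.

(** Divide cos x = sinc x + x sinc' x by sin x = x sinc x. *)
Lemma cotan_lnsinc (x : R) : 0 < x < PI -> cotan x = / x + lnsinc_d 1 x.
Proof.
  unfold cotan; intros Hx; assert (Hs := sinc_pos x ltac:(lra)).
  rewrite <- (sin_sinc x). change (cos x) with (sin_d 1 x); rewrite <- (sinc_d_rel 0 x).
  unfold lnsinc_d, sinc_r; simpl INR; field; lra.
Qed.

Lemma ln_sin (x : R) : 0 < x < PI -> ln (sin x) = ln x + lnsinc_d 0 x.
Proof.
  intros Hx; assert (Hs := sinc_pos x ltac:(lra)).
  rewrite <- sin_sinc, ln_mult by lra; reflexivity.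
Qed.

(** At x = 0 the Leibniz relation loses its leading term and gives each moment directly: 1, 0, -1/3,
    0, 1/5, 0. *)
Lemma lnsinc_d_at_0 :
  lnsinc_d 0 0 = 0 /\ lnsinc_d 1 0 = 0 /\ lnsinc_d 2 0 = - (1 / 3) /\
  lnsinc_d 3 0 = 0 /\ lnsinc_d 4 0 = - (2 / 15) /\ lnsinc_d 5 0 = 0.
Proof.
  assert (E := fun i => sinc_d_rel i 0).
  assert (E0 := E 0%nat); assert (E1 := E 1%nat); assert (E2 := E 2%nat);
  assert (E3 := E 3%nat); assert (E4 := E 4%nat); assert (E5 := E 5%nat).
  simpl in E0, E1, E2, E3, E4, E5; rewrite ?sin_0, ?cos_0 in *.
  assert (H0 : sinc_d 0 0 = 1) by lra.
  assert (H1 : sinc_d 1 0 = 0) by lra.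
  assert (H2 : sinc_d 2 0 = - (1 / 3)) by lra.
  assert (H3 : sinc_d 3 0 = 0) by lra.
  assert (H4 : sinc_d 4 0 = 1 / 5) by lra.
  assert (H5 : sinc_d 5 0 = 0) by lra.
  unfold lnsinc_d, sinc_r; rewrite H0, H1, H2, H3, H4, H5, ln_1.
  repeat split; field.
Qed.

(** Starting from sinc(pi/2) = 2/pi, the Leibniz relation is solved for one order after another.
    Only the orders that enter Euler-Maclaurin are recorded. In orders 2 and 4 the integer comes
    from ln sin x and the power of [PI] from -ln x. *)
Lemma lnsinc_d_at_PI2 :
  lnsinc_d 0 (PI / 2) = ln (2 / PI) /\ lnsinc_d 1 (PI / 2) = - (2 / PI) /\
  lnsinc_d 2 (PI / 2) = - 1 + 4 / PI ^ 2 /\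
  lnsinc_d 4 (PI / 2) = - 2 + 96 / PI ^ 4.
Proof.
  assert (HP := PI_RGT_0).
  assert (E := fun i => sinc_d_rel i (PI / 2)).
  assert (E0 := E 0%nat); assert (E1 := E 1%nat); assert (E2 := E 2%nat);
  assert (E3 := E 3%nat); assert (Es := sin_sinc (PI / 2)); clear E.
  simpl in E0, E1, E2, E3; rewrite ?sin_PI2, ?cos_PI2 in *.
  set (p := PI) in *.
  assert (S0 : sinc_d 0 (p / 2) = 2 / p).
  { apply (Rmult_eq_reg_l (p / 2)); [rewrite Es; field|]; lra. }
  assert (S1 : sinc_d 1 (p / 2) = - 4 / p ^ 2).
  { apply (Rmult_eq_reg_l (p / 2)); [|lra].
    replace (p / 2 * sinc_d 1 (p / 2)) with (- sinc_d 0 (p / 2)) by lra.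
    rewrite S0; field; lra. }
  assert (S2 : sinc_d 2 (p / 2) = 2 / p * (- 1 + 8 / p ^ 2)).
  { apply (Rmult_eq_reg_l (p / 2)); [|lra].
    replace (p / 2 * sinc_d 2 (p / 2)) with (- 1 - 2 * sinc_d 1 (p / 2)) by lra.
    rewrite S1; field; lra. }
  assert (S3 : sinc_d 3 (p / 2) = 2 / p * (6 / p - 48 / p ^ 3)).
  { apply (Rmult_eq_reg_l (p / 2)); [|lra].
    replace (p / 2 * sinc_d 3 (p / 2)) with (- 3 * sinc_d 2 (p / 2)) by lra.
    rewrite S2; field; lra. }
  assert (S4 : sinc_d 4 (p / 2) = 2 / p * (1 - 8 / p * (6 / p - 48 / p ^ 3))).
  { apply (Rmult_eq_reg_l (p / 2)); [|lra].
    replace (p / 2 * sinc_d 4 (p / 2)) with (1 - 4 * sinc_d 3 (p / 2)) by lra.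
    rewrite S3; field; lra. }
  unfold lnsinc_d, sinc_r; rewrite S0, S1, S2, S3, S4.
  split; [reflexivity | repeat split; field; lra].
Qed.

(** Continuity on a compact interval; this one constant controls every remainder of the regular
    part. *)
Lemma lnsinc_d_6_bounded :
  exists M, forall x, 0 <= x <= PI / 2 -> Rabs (lnsinc_d 6 x) <= M.
Proof.
  assert (HP := PI_RGT_0).
  destruct (continuity_ab_maj (fun x => Rabs (lnsinc_d 6 x)) 0 (PI / 2)) as [m [Hm _]].
  - lra.
  - intros x Hx.
    apply (continuity_pt_comp (lnsinc_d 6) Rabs); [|apply Rcontinuity_abs].
    assert (E : forall j, ex_derive (sinc_r j) x).
    { intros j; eexists; apply sinc_r_derive, sinc_pos; lra. }
    apply continuity_pt_filterlim.
    apply (ex_derive_continuous (lnsinc_d 6)).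
    unfold lnsinc_d; cbv zeta; auto_derive; repeat split; apply E.
  - eexists; exact Hm.
Qed.

(** * Taylor and Euler-Maclaurin formulas *)

Lemma taylor_monomial_derive (a x : R) (m : nat) :
  is_derive (fun y => (y - a) ^ S m / INR (fact (S m))) x ((x - a) ^ m / INR (fact m)).
Proof.
  assert (Hm := INR_fact_lt_0 m).
  assert (HSm := lt_0_INR (S m) ltac:(lia)).
  replace (INR (fact (S m))) with (INR (S m) * INR (fact m))
    by (rewrite <- mult_INR; reflexivity).
  auto_derive; [exact I|].
  change (match m with O => 1 | S _ => INR m + 1 end) with (INR (S m)).
  simpl pred; unfold Rminus; field; lra.
Qed.

(** Integrates a one-sided bound without integrals: M (x-a)^(m+1)/(m+1)! - f(x) vanishes at a and
    has a nonnegative derivative, so the mean value theorem makes it nonnegative at b. *)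
Lemma derive_pow_le (f df : R -> R) (a b M : R) (m : nat) :
  a <= b -> f a = 0 ->
  (forall x, a <= x <= b -> is_derive f x (df x)) ->
  (forall x, a <= x <= b -> df x <= M * ((x - a) ^ m / INR (fact m))) ->
  f b <= M * ((b - a) ^ S m / INR (fact (S m))).
Proof.
  intros Hab Hfa Hf Hdf.
  set (e := fun x : R => M * ((x - a) ^ S m / INR (fact (S m))) - f x).
  assert (De : forall x, a <= x <= b ->
    is_derive e x (M * ((x - a) ^ m / INR (fact m)) - df x)).
  { intros x Hx; unfold e.
    apply (is_derive_minus (fun x : R => M * ((x - a) ^ S m / INR (fact (S m)))) f);
      [|apply Hf, Hx].
    apply is_derive_scal, taylor_monomial_derive. }
  destruct (MVT_gen e a b (fun x => M * ((x - a) ^ m / INR (fact m)) - df x)) as [t [Ht E]].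
  - intros x Hx; rewrite Rmin_left, Rmax_right in Hx by lra; apply De; lra.
  - intros x Hx; rewrite Rmin_left, Rmax_right in Hx by lra.
    apply continuity_pt_filterlim, (ex_derive_continuous e).
    eexists; apply De; lra.
  - rewrite Rmin_left, Rmax_right in Ht by lra.
    specialize (Hdf t Ht).
    assert (0 <= (M * ((t - a) ^ m / INR (fact m)) - df t) * (b - a))
      by (apply Rmult_le_pos; lra).
    unfold e in E; rewrite Hfa, Rminus_diag in E.
    replace (M * (0 ^ S m / INR (fact (S m)))) with 0 in E
      by (simpl pow; unfold Rdiv; ring).
    lra.
Qed.

(* The last summand is cancelled on purpose: the Taylor polynomial has degree [m - 1], and this
   form avoids a sum up to [m - 1] at [m = 0]. *)
Lemma taylor_chain (f : nat -> R -> R) (a b M : R) (m : nat) :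
  a <= b ->
  (forall i x, (i < m)%nat -> a <= x <= b -> is_derive (f i) x (f (S i) x)) ->
  (forall x, a <= x <= b -> Rabs (f m x) <= M) ->
  forall x, a <= x <= b ->
  Rabs (f 0%nat x - sum_n_m (fun i => f i a * ((x - a) ^ i / INR (fact i))) 0 m
        + f m a * ((x - a) ^ m / INR (fact m)))
  <= M * ((x - a) ^ m / INR (fact m)).
Proof.
  intros Hab; revert f; induction m as [|m IH]; intros f Hf HM x Hx.
  - rewrite sum_n_n; simpl; specialize (HM x Hx).
    rewrite (Rdiv_diag 1), !Rmult_1_r by lra.
    replace (f 0%nat x - f 0%nat a + f 0%nat a) with (f 0%nat x) by ring; exact HM.
  - specialize (IH (fun i => f (S i)) ltac:(intros; apply Hf; [lia|assumption]) HM).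
    (* The derivative of [T] is exactly the quantity that the induction hypothesis bounds for the
       shifted family; [derive_pow_le] for [T] and [- T] then integrates this bound. *)
    set (T := fun y : R => f 0%nat y - sum_n_m (fun i => f i a * ((y - a) ^ i / INR (fact i))) 0 m).
    assert (Dsum : forall y : R,
      is_derive (fun y : R => sum_n_m (fun i => f i a * ((y - a) ^ i / INR (fact i))) 0 m) y
        (sum_n_m (fun i => f (S i) a * ((y - a) ^ i / INR (fact i))) 0 m
         - f (S m) a * ((y - a) ^ m / INR (fact m)))).
    { intros y; clear; induction m as [|m IHm].
      - apply (is_derive_ext (fun y : R => f 0%nat a * ((y - a) ^ 0 / INR (fact 0)))).
        + intros t; symmetry; exact (sum_n_n _ 0%nat).
        + rewrite sum_n_n; auto_derive; [exact I|]; simpl; field.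
      - apply (is_derive_ext (fun y : R => sum_n_m (fun i => f i a * ((y - a) ^ i / INR (fact i))) 0 m
           + f (S m) a * ((y - a) ^ S m / INR (fact (S m))))).
        + intros t; rewrite sum_n_m_snoc by lia; reflexivity.
        + rewrite sum_n_m_snoc by lia.
          replace (_ - _) with
            ((sum_n_m (fun i => f (S i) a * ((y - a) ^ i / INR (fact i))) 0 m
              - f (S m) a * ((y - a) ^ m / INR (fact m)))
             + f (S m) a * ((y - a) ^ m / INR (fact m))) by ring.
          apply (is_derive_plus (fun y : R => sum_n_m (fun i => f i a * ((y - a) ^ i / INR (fact i))) 0 m));
            [exact IHm|].
          apply is_derive_scal, taylor_monomial_derive. }
    assert (DT : forall y, a <= y <= x -> is_derive T y (f 1%nat y -
      (sum_n_m (fun i => f (S i) a * ((y - a) ^ i / INR (fact i))) 0 m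
       - f (S m) a * ((y - a) ^ m / INR (fact m))))).
    { intros y Hy; unfold T.
      apply (is_derive_minus (f 0%nat)); [apply Hf; [lia|lra] | apply Dsum]. }
    assert (T0 : T a = 0).
    { unfold T.
      assert (E : sum_n_m (fun i => f i a * ((a - a) ^ i / INR (fact i))) 0 m = f 0%nat a).
      { clear; induction m as [|m IHm].
        - rewrite sum_n_n; simpl; field.
        - rewrite sum_n_m_snoc, IHm by lia; rewrite Rminus_diag.
          change (f 0%nat a + f (S m) a * (0 ^ S m / INR (fact (S m))) = f 0%nat a).
          simpl pow; unfold Rdiv; ring. }
      rewrite E; ring. }
    rewrite sum_n_m_snoc by lia.
    match goal with |- Rabs ?u <= _ => replace u with (T x) by (unfold T; ring) end.
    apply Rabs_le; split.
    + apply Ropp_le_cancel; rewrite Ropp_involutive.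
      refine (derive_pow_le (fun y => - T y) (fun y => - _) a x M m (proj1 Hx) _ _ _).
      * rewrite T0; ring.
      * intros y Hy; exact (is_derive_opp T y _ (DT y Hy)).
      * intros y Hy; specialize (IH y ltac:(lra)); apply Rabs_le_between in IH; lra.
    + refine (derive_pow_le T _ a x M m (proj1 Hx) T0 DT _).
      intros y Hy; specialize (IH y ltac:(lra)); apply Rabs_le_between in IH; lra.
Qed.

(* [f] lists an antiderivative [f 0], the summand [f 1] and the derivatives of the summand. *)
Definition euler_maclaurin_defect (f : nat -> R -> R) (a b : R) : R :=
  let h := b - a in
  f 0%nat b - f 0%nat a - h / 2 * (f 1%nat a + f 1%nat b)
  + h ^ 2 / 12 * (f 2%nat b - f 2%nat a) - h ^ 4 / 720 * (f 4%nat b - f 4%nat a).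

(** Expand f 0, f 1, f 2 and f 4 at a, each up to the sixth member of the family. The weights 1/2,
    1/12 = B_2/2! and -1/720 = B_4/4! cancel all Taylor polynomials, and the remainders add up to at
    most M h^6 (1/720 + 1/240 + 1/288 + 1/1440). *)
Lemma euler_maclaurin_step (f : nat -> R -> R) (a b M : R) :
  a <= b ->
  (forall i x, (i < 6)%nat -> a <= x <= b -> is_derive (f i) x (f (S i) x)) ->
  (forall x, a <= x <= b -> Rabs (f 6%nat x) <= M) ->
  Rabs (euler_maclaurin_defect f a b) <= M * (b - a) ^ 6.
Proof.
  intros Hab Hf HM; unfold euler_maclaurin_defect; cbv zeta.
  assert (T : forall j m, (j + m = 6)%nat ->
    Rabs (f j b - sum_n_m (fun i => f (i + j)%nat a * ((b - a) ^ i / INR (fact i))) 0 m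
        + f 6%nat a * ((b - a) ^ m / INR (fact m))) <= M * ((b - a) ^ m / INR (fact m))).
  { intros j m Hjm; rewrite <- Hjm, (Nat.add_comm j m).
    refine (taylor_chain (fun i => f (i + j)%nat) a b M m Hab _ _ b ltac:(lra)).
    - intros i x Hi Hx; apply Hf; [lia | exact Hx].
    - rewrite Nat.add_comm, Hjm; exact HM. }
  assert (HM0 : 0 <= M * (b - a) ^ 6).
  { apply Rmult_le_pos; [|apply pow_le; lra].
    specialize (HM a ltac:(lra)); assert (H := Rabs_pos (f 6%nat a)); lra. }
  assert (T0 := T 0%nat 6%nat eq_refl); assert (T1 := T 1%nat 5%nat eq_refl);
  assert (T2 := T 2%nat 4%nat eq_refl); assert (T4 := T 4%nat 2%nat eq_refl); clear T.
  rewrite !sum_n_m_snoc, (sum_n_n (G := R_AbelianMonoid)) in T0 by lia.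
  rewrite !sum_n_m_snoc, (sum_n_n (G := R_AbelianMonoid)) in T1 by lia.
  rewrite !sum_n_m_snoc, (sum_n_n (G := R_AbelianMonoid)) in T2 by lia.
  rewrite !sum_n_m_snoc, (sum_n_n (G := R_AbelianMonoid)) in T4 by lia.
  simpl Nat.add in T0, T1, T2, T4; simpl fact in T0, T1, T2, T4.
  set (h := b - a) in *.
  rewrite ?(INR_IZR_INZ 1), ?(INR_IZR_INZ 2), ?(INR_IZR_INZ 6), ?(INR_IZR_INZ 24), ?(INR_IZR_INZ 120), ?(INR_IZR_INZ 720) in *.
  simpl Z.of_nat in T0, T1, T2, T4.
  match type of T0 with Rabs ?u <= _ => set (u0 := u) in T0 end.
  match type of T1 with Rabs ?u <= _ => set (u1 := u) in T1 end.
  match type of T2 with Rabs ?u <= _ => set (u2 := u) in T2 end.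
  match type of T4 with Rabs ?u <= _ => set (u4 := u) in T4 end.
  assert (Hh : 0 <= h) by (unfold h; lra).
  (* Multiplication by h^j brings the four remainders to the common order h^6. *)
  assert (B : forall u c j m, (j + m = 6)%nat -> Rabs u <= M * (h ^ m / c) ->
    - (M * h ^ 6 / c) <= h ^ j * u <= M * h ^ 6 / c).
  { intros u c j m Hjm Hu; apply Rabs_le_between in Hu.
    assert (Hj := pow_le h j Hh).
    replace (M * h ^ 6 / c) with (h ^ j * (M * (h ^ m / c)))
      by (rewrite <- Hjm, pow_add; unfold Rdiv; ring).
    split; [rewrite Ropp_mult_distr_r|]; apply Rmult_le_compat_l; lra. }
  assert (B0 := B _ _ 0%nat 6%nat eq_refl T0); assert (B1 := B _ _ 1%nat 5%nat eq_refl T1);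
  assert (B2 := B _ _ 2%nat 4%nat eq_refl T2); assert (B4 := B _ _ 4%nat 2%nat eq_refl T4).
  match goal with |- Rabs ?u <= _ =>
    replace u with (h ^ 0 * u0 - h ^ 1 * u1 / 2 + h ^ 2 * u2 / 12 - h ^ 4 * u4 / 720)
      by (unfold u0, u1, u2, u4; field) end.
  apply Rabs_le; split; lra.
Qed.

(** One step per cell: the endpoint terms telescope, and passing from the trapezoidal sum to right
    endpoints produces the h/2 term. *)
Lemma euler_maclaurin_grid (f : nat -> R -> R) (h M : R) (n : nat) :
  0 <= h ->
  (forall i x, (i < 6)%nat -> 0 <= x <= INR n * h -> is_derive (f i) x (f (S i) x)) ->
  (forall x, 0 <= x <= INR n * h -> Rabs (f 6%nat x) <= M) ->
  Rabs (f 0%nat (INR n * h) - f 0%nat 0 - h * sum_n_m (fun l => f 1%nat (INR l * h)) 1 n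
        + h / 2 * (f 1%nat (INR n * h) - f 1%nat 0)
        + h ^ 2 / 12 * (f 2%nat (INR n * h) - f 2%nat 0)
        - h ^ 4 / 720 * (f 4%nat (INR n * h) - f 4%nat 0)) <= INR n * (M * h ^ 6).
Proof.
  intros Hh; induction n as [|n IH]; intros Hf HM.
  - rewrite sum_n_m_empty by lia; simpl INR; rewrite !Rmult_0_l.
    match goal with |- Rabs ?u <= _ => replace u with 0 by ring end.
    rewrite Rabs_R0; lra.
  - rewrite sum_n_m_snoc by lia.
    assert (E : INR (S n) * h = INR n * h + h) by (rewrite S_INR; ring).
    assert (H0 : 0 <= INR n * h) by (apply Rmult_le_pos; [apply pos_INR | exact Hh]).
    assert (I1 := IH ltac:(intros; apply Hf; lra || assumption) ltac:(intros; apply HM; lra)).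
    assert (I2 := euler_maclaurin_step f (INR n * h) (INR (S n) * h) M ltac:(lra)
      ltac:(intros; apply Hf; lra || assumption) ltac:(intros; apply HM; lra)).
    unfold euler_maclaurin_defect in I2; cbv zeta in I2.
    replace (INR (S n) * h - INR n * h) with h in I2 by lra.
    match type of I1 with Rabs ?u <= _ => set (u1 := u) in I1 end.
    match type of I2 with Rabs ?u <= _ => set (u2 := u) in I2 end.
    match goal with |- Rabs ?u <= _ => replace u with (u1 + u2) by (unfold u1, u2; field) end.
    eapply Rle_trans; [apply Rabs_triang|]; rewrite (S_INR n); lra.
Qed.

(** * Harmonic numbers *)

Definition ln_d (i : nat) (x : R) : R :=
  match i with
  | O => ln x
  | S j => (-1) ^ j * INR (fact j) / x ^ S j
  end.

Lemma ln_d_derive (i : nat) (x : R) : 0 < x -> is_derive (ln_d i) x (ln_d (S i) x).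
Proof.
  intros Hx; destruct i as [|j]; unfold ln_d.
  - auto_derive; [exact Hx | simpl; field; lra].
  - auto_derive; [apply (pow_nonzero x (S j)); lra|].
    assert (Hp := pow_nonzero x j ltac:(lra)).
    change (fact (S j)) with (S j * fact j)%nat; rewrite mult_INR.
    change (match j with O => 1 | S _ => INR j + 1 end) with (INR (S j)).
  simpl pred; set (c := INR (S j)); simpl pow; field; split; lra.
Qed.

(** H_n minus its Euler-Maclaurin expansion without the constant term, so that the limit is
    gamma. *)
Definition harmonic_defect (n : nat) : R :=
  harmonic n - ln (INR n) - / (2 * INR n) + / (12 * INR n ^ 2) - / (120 * INR n ^ 4).

Lemma harmonic_S (n : nat) : harmonic (S n) = harmonic n + / INR (S n).
Proof. unfold harmonic; rewrite sum_n_m_snoc by lia; reflexivity. Qed.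

(** The increment is minus the Euler-Maclaurin defect of ln on [n, n+1]; the constant is 5! from the
    sixth derivative -5!/x^6. *)
Lemma harmonic_defect_step (n : nat) :
  (0 < n)%nat ->
  Rabs (harmonic_defect (S n) - harmonic_defect n) <= 120 / INR n ^ 6.
Proof.
  intros Hn; apply lt_0_INR in Hn.
  assert (H := euler_maclaurin_step ln_d (INR n) (INR (S n)) (120 / INR n ^ 6)).
  rewrite S_INR in H; replace (INR n + 1 - INR n) with 1 in H by ring.
  rewrite pow1, Rmult_1_r in H.
  replace (harmonic_defect (S n) - harmonic_defect n)
    with (- euler_maclaurin_defect ln_d (INR n) (INR n + 1)).
  - rewrite Rabs_Ropp; apply H; [lra | intros; apply ln_d_derive; lra |].
    intros x Hx; unfold ln_d.
    assert (Hp : 0 < INR n ^ 6 <= x ^ 6) by (split; [apply pow_lt; lra | apply pow_incr; lra]).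
    simpl fact; rewrite INR_IZR_INZ; simpl Z.of_nat.
    replace ((-1) ^ 5 * 120 / x ^ 6) with (- (120 * / x ^ 6)) by (unfold Rdiv; ring).
    rewrite Rabs_Ropp, Rabs_pos_eq.
    + apply Rmult_le_compat_l; [lra|]; apply Rinv_le_contravar; lra.
    + apply Rmult_le_pos; [lra|]; apply Rlt_le, Rinv_0_lt_compat; lra.
  - unfold harmonic_defect; rewrite harmonic_S, S_INR.
    unfold euler_maclaurin_defect, ln_d; cbv zeta; simpl fact; simpl INR.
    field; lra.
Qed.

(* The tail of [sum 1/m^6] is dominated by the telescoping [n^-4 * sum 2/(m(m+1))]. *)
Lemma harmonic_defect_cauchy (n p : nat) :
  (0 < n)%nat ->
  Rabs (harmonic_defect (n + p) - harmonic_defect n)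
  <= 240 / INR n ^ 4 * (/ INR n - / INR (n + p)).
Proof.
  intros Hn; assert (Hn' := lt_0_INR n Hn); induction p as [|p IH].
  - rewrite Nat.add_0_r, !Rminus_diag, Rabs_R0; lra.
  - rewrite Nat.add_succ_r.
    replace (harmonic_defect (S (n + p)) - harmonic_defect n) with
      ((harmonic_defect (S (n + p)) - harmonic_defect (n + p))
       + (harmonic_defect (n + p) - harmonic_defect n)) by ring.
    eapply Rle_trans; [apply Rabs_triang|].
    assert (Hs := harmonic_defect_step (n + p) ltac:(lia)).
    assert (Hm : INR n <= INR (n + p)) by (apply le_INR; lia).
    assert (H1 : 1 <= INR (n + p)) by (apply (le_INR 1); lia).
    rewrite S_INR; set (m := INR (n + p)) in *; set (x := INR n) in *.
    assert (Hx4 := pow_lt x 4 Hn').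
    assert (H4 : / m ^ 4 <= / x ^ 4)
      by (apply Rinv_le_contravar; [|apply pow_incr]; lra).
    assert (H2 : / m ^ 2 <= 2 * (/ m - / (m + 1))).
    { replace (2 * (/ m - / (m + 1))) with (/ (m * ((m + 1) / 2))) by (field; lra).
      apply Rinv_le_contravar; [apply Rmult_lt_0_compat; lra|].
      simpl; rewrite Rmult_1_r; apply Rmult_le_compat_l; lra. }
    assert (120 / m ^ 6 <= 120 * (/ x ^ 4 * (2 * (/ m - / (m + 1))))).
    { replace (120 / m ^ 6) with (120 * (/ m ^ 4 * / m ^ 2)) by (field; lra).
      apply Rmult_le_compat_l; [lra|]; apply Rmult_le_compat; try assumption;
        apply Rlt_le, Rinv_0_lt_compat, pow_lt; lra. }
    unfold Rdiv in *; lra.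
Qed.

Lemma is_lim_seq_inv_pow (c : R) (j : nat) :
  (0 < j)%nat -> is_lim_seq (fun n => c / INR n ^ j) 0.
Proof.
  intros Hj; destruct j as [|j]; [lia|].
  replace 0 with (c * 0 ^ S j) by (simpl; ring).
  apply (is_lim_seq_ext_loc (fun n => c * (/ INR n) ^ S j)).
  - exists 1%nat; intros n Hn; rewrite pow_inv; reflexivity.
  - apply (is_lim_seq_scal_l (fun n => (/ INR n) ^ S j) c (0 ^ S j)).
    apply (is_lim_seq_continuous (fun x => x ^ S j) (fun n => / INR n) 0).
    + apply derivable_continuous_pt, derivable_pt_pow.
    + replace (Finite 0) with (Rbar_inv p_infty) by reflexivity.
      apply is_lim_seq_inv; [apply is_lim_seq_INR | discriminate].
Qed.

(** The Cauchy estimate yields some limit. The correction terms tend to 0, so H_n - ln n has the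
    same limit, which is therefore the value of [Lim_seq] defining [euler_gamma]. *)
Lemma is_lim_seq_harmonic_defect : is_lim_seq harmonic_defect euler_gamma.
Proof.
  assert (Hc : ex_finite_lim_seq harmonic_defect).
  { apply ex_lim_seq_cauchy_corr; intros eps.
    (* 480 = 2 * 240: each of the two tails must stay below eps/2. *)
    assert (Hl := is_lim_seq_inv_pow 480 5 ltac:(lia)).
    apply is_lim_seq_spec in Hl; destruct (Hl eps) as [N HN].
    exists (S N).
    assert (K : forall n, (S N <= n)%nat -> Rabs (harmonic_defect n - harmonic_defect (S N)) < eps / 2).
    { intros n Hn; replace n with (S N + (n - S N))%nat by lia.
      eapply Rle_lt_trans; [apply harmonic_defect_cauchy; lia|].
      specialize (HN (S N) ltac:(lia)); rewrite Rminus_0_r in HN.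
      assert (HS := lt_0_INR (S N) ltac:(lia)).
      assert (Hi : 0 < / INR (S N + (n - S N))) by (apply Rinv_0_lt_compat, lt_0_INR; lia).
      assert (H4 := pow_lt _ 4 HS).
      assert (H240 : 0 < 240 / INR (S N) ^ 4) by (apply Rdiv_lt_0_compat; lra).
      assert (Hq : 480 / INR (S N) ^ 5 = 2 * (240 / INR (S N) ^ 4 * / INR (S N))) by (field; lra).
      apply Rle_lt_trans with (240 / INR (S N) ^ 4 * / INR (S N)).
      - apply Rmult_le_compat_l; lra.
      - apply Rabs_lt_between in HN; lra. }
    intros n m Hn Hm.
    replace (harmonic_defect n - harmonic_defect m) with
      ((harmonic_defect n - harmonic_defect (S N)) - (harmonic_defect m - harmonic_defect (S N))) by ring.
    assert (Kn := K n Hn); assert (Km := K m Hm).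
    apply Rabs_lt_between in Kn; apply Rabs_lt_between in Km.
    apply Rabs_lt_between; lra. }
  destruct Hc as [l Hl].
  replace euler_gamma with l; [exact Hl|].
  unfold euler_gamma.
  rewrite (is_lim_seq_unique _ l); [reflexivity|].
  apply (is_lim_seq_ext_loc (fun n => harmonic_defect n
    + ((1 / 2) / INR n ^ 1 + ((- 1 / 12) / INR n ^ 2 + (1 / 120) / INR n ^ 4)))).
  - exists 1%nat; intros n Hn; assert (Hn' := lt_0_INR n Hn).
    unfold harmonic_defect; field; lra.
  - replace (Finite l) with (Rbar_plus l (0 + (0 + 0))) by (simpl; f_equal; ring).
    apply is_lim_seq_plus'; [exact Hl|].
    repeat apply is_lim_seq_plus'; apply is_lim_seq_inv_pow; lia.
Qed.

(** Let p tend to infinity in [harmonic_defect_cauchy], having dropped 1/(n+p). *)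
Lemma harmonic_asymptotics (n : nat) :
  (0 < n)%nat -> Rabs (harmonic_defect n - euler_gamma) <= 240 / INR n ^ 5.
Proof.
  intros Hn; assert (Hn' := lt_0_INR n Hn).
  rewrite Rabs_minus_sym.
  apply (is_lim_seq_le (fun p => Rabs (harmonic_defect (p + n) - harmonic_defect n))
           (fun _ => 240 / INR n ^ 5) (Rabs (euler_gamma - harmonic_defect n)) (240 / INR n ^ 5)).
  - intros p; rewrite Nat.add_comm.
    eapply Rle_trans; [apply harmonic_defect_cauchy, Hn|].
    assert (Hi : 0 < / INR (n + p)) by (apply Rinv_0_lt_compat, lt_0_INR; lia).
    replace (240 / INR n ^ 5) with (240 / INR n ^ 4 * / INR n) by (field; lra).
    apply Rmult_le_compat_l; [|lra].
    apply Rlt_le, Rdiv_lt_0_compat; [lra | apply pow_lt; lra].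
  - apply (is_lim_seq_abs _ (euler_gamma - harmonic_defect n)).
    apply is_lim_seq_minus'; [|apply is_lim_seq_const].
    apply is_lim_seq_incr_n, is_lim_seq_harmonic_defect.
  - apply is_lim_seq_const.
Qed.

(** * The cosecant sum as a sum of cotangents *)

Lemma csc_cotan (x : R) : 0 < x < PI -> csc x = cotan (x / 2) - cotan x.
Proof.
  intros Hx; unfold csc, cotan.
  assert (Hs := sin_gt_0 (x / 2) ltac:(lra) ltac:(lra)).
  assert (Hc := cos_gt_0 (x / 2) ltac:(lra) ltac:(lra)).
  assert (E := sin2_cos2 (x / 2)); unfold Rsqr in E.
  set (y := x / 2) in *; replace x with (2 * y) by (unfold y; field).
  rewrite sin_2a, cos_2a.
  transitivity ((sin y * sin y + cos y * cos y) / (2 * sin y * cos y));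
    [rewrite E|]; field; lra.
Qed.

Lemma grid_bounds (n l : nat) :
  (1 <= l <= n - 1)%nat -> 0 < PI * INR l / INR n < PI.
Proof.
  intros Hl; assert (HP := PI_RGT_0).
  assert (H1 := lt_0_INR l ltac:(lia)); assert (H2 := lt_INR l n ltac:(lia)).
  split.
  - apply Rdiv_lt_0_compat; [apply Rmult_lt_0_compat|]; lra.
  - apply Rlt_div_l; [lra|]; apply Rmult_lt_compat_l; lra.
Qed.

(** The reflection l -> n - l changes the sign of every term, so the sum equals its own negative. *)
Lemma cotan_sum_0 (n : nat) :
  sum_n_m (fun l => cotan (PI * INR l / INR n)) 1 (n - 1) = 0.
Proof.
  destruct n as [|m]; [apply (sum_n_m_empty); lia|].
  replace (S m - 1)%nat with m by lia.
  assert (Hn := lt_0_INR (S m) ltac:(lia)).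
  assert (E := sum_n_m_rev (fun l => cotan (PI * INR l / INR (S m))) m).
  rewrite (sum_n_m_R_ext _ (fun l => (-1) * cotan (PI * INR l / INR (S m)) + 0 * 0)) in E.
  - rewrite (sum_n_m_lin (fun l => cotan (PI * INR l / INR (S m))) (fun _ => 0)) in E; lra.
  - intros l Hl; rewrite minus_INR by lia.
    replace (PI * (INR (S m) - INR l) / INR (S m)) with (PI - PI * INR l / INR (S m))
      by (field; lra).
    assert (Hg := grid_bounds (S m) l ltac:(lia)).
    assert (Hs := sin_gt_0 _ (proj1 Hg) (proj2 Hg)).
    unfold cotan; rewrite sin_PI_x.
    replace (PI - PI * INR l / INR (S m)) with (- (PI * INR l / INR (S m)) + PI) by ring.
    rewrite neg_cos, cos_neg; field; lra.
Qed.

Lemma cosec_sum_0 (n : nat) :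
  (0 < n)%nat ->
  cosec_sum n 0 = sum_n_m (fun l => cotan (INR l * (PI / (2 * INR n)))) 1 n.
Proof.
  intros Hn; destruct n as [|m]; [lia|].
  assert (Hn' := lt_0_INR (S m) Hn).
  (* The extra term l = n is cot(pi/2) = 0; with it the grid ends exactly at pi/2, ready for
     [euler_maclaurin_grid]. *)
  rewrite (sum_n_m_snoc _ 1 m) by lia.
  replace (INR (S m) * (PI / (2 * INR (S m)))) with (PI / 2) by (field; lra).
  assert (E : cotan (PI / 2) = 0) by (unfold cotan; rewrite cos_PI2; unfold Rdiv; ring).
  rewrite E, Rplus_0_r.
  assert (Z := cotan_sum_0 (S m)).
  unfold cosec_sum; replace (S m - 1)%nat with m in * by lia.
  transitivity (sum_n_m (fun l => 1 * cotan (INR l * (PI / (2 * INR (S m))))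
                 + (-1) * cotan (PI * INR l / INR (S m))) 1 m).
  - apply sum_n_m_R_ext; intros l Hl.
    rewrite (csc_cotan (PI * INR l / INR (S m)) (grid_bounds (S m) l ltac:(lia))).
    replace (2 * PI * INR 0 * INR l / INR (S m)) with 0 by (simpl (INR 0); unfold Rdiv; ring).
    replace (PI * INR l / INR (S m) / 2) with (INR l * (PI / (2 * INR (S m)))) by (field; lra).
    rewrite cos_0; ring.
  - rewrite (sum_n_m_lin (fun l => cotan (INR l * (PI / (2 * INR (S m)))))
               (fun l => cotan (PI * INR l / INR (S m)))), Z; ring.
Qed.

(** Telescopes, since 2 sin(t/2) sin(lt) = cos((l - 1/2)t) - cos((l + 1/2)t). *)
Lemma sin_sum (t : R) (m : nat) :
  2 * sin (t / 2) * sum_n_m (fun l => sin (INR l * t)) 1 m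
  = cos (t / 2) - cos ((INR m + 1 / 2) * t).
Proof.
  induction m as [|m IH].
  - rewrite sum_n_m_empty by lia; simpl INR.
    replace ((0 + 1 / 2) * t) with (t / 2) by field; simpl; ring.
  - rewrite sum_n_m_snoc, Rmult_plus_distr_l, IH by lia.
    replace ((INR m + 1 / 2) * t) with (INR (S m) * t - t / 2) by (rewrite S_INR; field).
    replace ((INR (S m) + 1 / 2) * t) with (INR (S m) * t + t / 2) by field.
    rewrite cos_minus, cos_plus; ring.
Qed.

Lemma cos_odd_PI_minus (m : nat) (x : R) : cos ((2 * INR m + 1) * PI - x) = - cos x.
Proof.
  replace ((2 * INR m + 1) * PI - x) with ((- x + PI) + 2 * INR m * PI) by ring.
  rewrite cos_period, neg_cos, cos_neg; reflexivity.
Qed.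

(** With x = pi l/n and t = (2nu+1) pi/n, the summands differ by (cos(lt + x) - cos(lt - x)) csc x =
    -2 sin(lt). The sine sum is cot(t/2), because (n - 1/2)t = (2nu+1) pi - t/2 turns the last
    cosine into -cos(t/2). *)
Lemma cosec_sum_S (n nu : nat) :
  (nu < n)%nat ->
  cosec_sum n (S nu) = cosec_sum n nu - 2 * cotan ((2 * INR nu + 1) * (PI / (2 * INR n))).
Proof.
  intros H; assert (HP := PI_RGT_0).
  assert (Hnu := pos_INR nu); assert (Hn := le_INR (S nu) n H); rewrite S_INR in Hn.
  set (t := 2 * ((2 * INR nu + 1) * (PI / (2 * INR n)))).
  assert (E : cosec_sum n (S nu) =
    1 * cosec_sum n nu + (- 2) * sum_n_m (fun l => sin (INR l * t)) 1 (n - 1)).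
  { unfold cosec_sum.
    rewrite <- (sum_n_m_lin (fun l => cos (2 * PI * INR nu * INR l / INR n) * csc (PI * INR l / INR n))).
    apply sum_n_m_R_ext; intros l Hl.
    assert (Hg := grid_bounds n l Hl).
    assert (Hs := sin_gt_0 _ (proj1 Hg) (proj2 Hg)).
    set (x := PI * INR l / INR n) in *.
    replace (2 * PI * INR (S nu) * INR l / INR n) with (INR l * t + x)
      by (unfold t, x; rewrite S_INR; field; lra).
    replace (2 * PI * INR nu * INR l / INR n) with (INR l * t - x)
      by (unfold t, x; field; lra).
    rewrite cos_minus, cos_plus; unfold csc; field; lra. }
  rewrite E.
  assert (S := sin_sum t (n - 1)).
  replace ((INR (n - 1) + 1 / 2) * t) with ((2 * INR nu + 1) * PI - t / 2) in S
    by (rewrite minus_INR by lia; unfold t; simpl INR; field; lra).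
  rewrite cos_odd_PI_minus in S.
  replace ((2 * INR nu + 1) * (PI / (2 * INR n))) with (t / 2) by (unfold t; field; lra).
  assert (Ht : 0 < t / 2 < PI).
  { replace (t / 2) with (PI * ((2 * INR nu + 1) / (2 * INR n))) by (unfold t; field; lra).
    assert (0 < (2 * INR nu + 1) / (2 * INR n) < 1)
      by (split; [apply Rdiv_lt_0_compat; lra | apply Rlt_div_l; lra]).
    split; [apply Rmult_lt_0_compat; lra|].
    rewrite <- (Rmult_1_r PI) at 2; apply Rmult_lt_compat_l; lra. }
  assert (Hs := sin_gt_0 _ (proj1 Ht) (proj2 Ht)).
  unfold cotan.
  replace (sum_n_m (fun l => sin (INR l * t)) 1 (n - 1)) with (cos (t / 2) / sin (t / 2)); [ring|].
  apply (Rmult_eq_reg_l (2 * sin (t / 2))); [|lra].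
  rewrite S; field; lra.
Qed.

Lemma cosec_sum_cotan (n nu : nat) :
  (nu < n)%nat ->
  cosec_sum n nu =
  sum_n_m (fun l => cotan (INR l * (PI / (2 * INR n)))) 1 n
  - 2 * sum_n_m (fun j => cotan ((2 * INR j - 1) * (PI / (2 * INR n)))) 1 nu.
Proof.
  induction nu as [|nu IH]; intros H.
  - rewrite cosec_sum_0 by lia.
    rewrite (sum_n_m_empty _ 1 0) by lia; lra.
  - rewrite cosec_sum_S, IH, sum_n_m_snoc by lia.
    replace (2 * INR (S nu) - 1) with (2 * INR nu + 1) by (rewrite S_INR; ring); ring.
Qed.

(** * Error estimates *)

(** Sums the expansion 1/x - x/3 - x^3/45 of cot x over odd multiples of k; the odd numbers below
    2nu add up to nu^2, their cubes to nu^2 (2nu^2 - 1). *)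
Lemma odd_sums (k : R) (nu : nat) :
  0 < k ->
  sum_n_m (fun j => / ((2 * INR j - 1) * k) - (2 * INR j - 1) * k / 3
                    - ((2 * INR j - 1) * k) ^ 3 / 45) 1 nu
  = (harmonic (2 * nu) - harmonic nu / 2) / k - INR nu ^ 2 * k / 3
    - INR nu ^ 2 * (2 * INR nu ^ 2 - 1) * k ^ 3 / 45 :> R.
Proof.
  intros Hk; induction nu as [|nu IH].
  - unfold harmonic; simpl Nat.mul; rewrite !sum_n_m_empty by lia.
    simpl; field; lra.
  - rewrite sum_n_m_snoc, IH by lia.
    replace (2 * S nu)%nat with (S (S (2 * nu))) by lia.
    rewrite !harmonic_S, !S_INR, mult_INR; simpl (INR 2).
    assert (Hnu := pos_INR nu).
    field; repeat split; try lra.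
Qed.

(** The coefficients are the values at 0 divided by factorials, for example (2/15)/4! = 1/180; the
    factorials in the remainders are dropped. *)
Lemma taylor_lnsinc (M x : R) :
  (forall y, 0 <= y <= PI / 2 -> Rabs (lnsinc_d 6 y) <= M) ->
  0 <= x <= PI / 2 ->
  Rabs (lnsinc_d 0 x + x ^ 2 / 6 + x ^ 4 / 180) <= M * x ^ 6 /\
  Rabs (lnsinc_d 1 x + x / 3 + x ^ 3 / 45) <= M * x ^ 5.
Proof.
  intros HM Hx; assert (HP := PI_RGT_0).
  assert (M0 : 0 <= M).
  { specialize (HM x Hx); assert (H := Rabs_pos (lnsinc_d 6 x)); lra. }
  assert (D : forall i y, (i < 6)%nat -> 0 <= y <= PI / 2 -> is_derive (lnsinc_d i) y (lnsinc_d (S i) y))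
    by (intros; apply lnsinc_d_derive; [assumption | lra]).
  destruct lnsinc_d_at_0 as (Z0 & Z1 & Z2 & Z3 & Z4 & Z5).
  split.
  - assert (T := taylor_chain lnsinc_d 0 (PI / 2) M 6 ltac:(lra) D HM x Hx).
    rewrite !sum_n_m_snoc, (sum_n_n (G := R_AbelianMonoid)), Z0, Z1, Z2, Z3, Z4, Z5 in T by lia.
    simpl fact in T; rewrite !Rminus_0_r in T.
    rewrite ?(INR_IZR_INZ 1), ?(INR_IZR_INZ 2), ?(INR_IZR_INZ 6), ?(INR_IZR_INZ 24),
      ?(INR_IZR_INZ 120), ?(INR_IZR_INZ 720) in T.
    simpl Z.of_nat in T.
    match type of T with Rabs ?u <= _ =>
      replace u with (lnsinc_d 0 x + x ^ 2 / 6 + x ^ 4 / 180) in T by field end.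
    eapply Rle_trans; [exact T|].
    apply Rmult_le_compat_l; [exact M0|].
    assert (H := pow_le x 6 (proj1 Hx)); lra.
  - assert (T := taylor_chain (fun i => lnsinc_d (S i)) 0 (PI / 2) M 5 ltac:(lra)
      ltac:(intros; apply D; [lia | assumption]) HM x Hx).
    rewrite !sum_n_m_snoc, (sum_n_n (G := R_AbelianMonoid)), Z1, Z2, Z3, Z4, Z5 in T by lia.
    simpl fact in T; rewrite !Rminus_0_r in T.
    rewrite ?(INR_IZR_INZ 1), ?(INR_IZR_INZ 2), ?(INR_IZR_INZ 6), ?(INR_IZR_INZ 24),
      ?(INR_IZR_INZ 120) in T.
    simpl Z.of_nat in T.
    match type of T with Rabs ?u <= _ =>
      replace u with (lnsinc_d 1 x + x / 3 + x ^ 3 / 45) in T by field end.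
    eapply Rle_trans; [exact T|].
    apply Rmult_le_compat_l; [exact M0|].
    assert (H := pow_le x 5 (proj1 Hx)); lra.
Qed.

(** The four terms bound, in order, the remainders of H_n, of the Riemann sum, of the odd cotangents
    and of ln sin(pi nu/n). The condition 2nu <= n keeps pi nu/n = 2 nu k in [0, pi/2], where [M] is
    valid. *)
Lemma cosec_sum_error (M : R) (n nu : nat) :
  (forall y, 0 <= y <= PI / 2 -> Rabs (lnsinc_d 6 y) <= M) ->
  (0 < nu)%nat -> (2 * nu <= n)%nat ->
  let k := PI / (2 * INR n) in
  Rabs (cosec_sum n nu - cosec_free_approx n nu)
  <= / k * (240 / INR n ^ 5) + / k * (INR n * (M * k ^ 6))
     + 2 * (INR nu * (M * (2 * INR nu * k) ^ 5)) + / k * (M * (2 * INR nu * k) ^ 6).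
Proof.
  intros HM Hnu Hn k; assert (HP := PI_RGT_0).
  assert (M0 : 0 <= M).
  { specialize (HM 0 ltac:(lra)); assert (H := Rabs_pos (lnsinc_d 6 0)); lra. }
  assert (Hnu' := lt_0_INR nu Hnu).
  assert (Hn' := le_INR _ _ Hn); rewrite mult_INR in Hn'; simpl (INR 2) in Hn'.
  assert (Hk : 0 < k) by (apply Rdiv_lt_0_compat; lra).
  assert (Hnk : INR n * k = PI / 2) by (unfold k; field; lra).
  assert (HB : 2 * INR nu * k <= PI / 2)
    by (rewrite <- Hnk; apply Rmult_le_compat_r; lra).
  set (E1 := harmonic_defect n - euler_gamma).
  assert (B1 : Rabs E1 <= 240 / INR n ^ 5) by (apply harmonic_asymptotics; lia).
  assert (B2 := euler_maclaurin_grid lnsinc_d k M n (Rlt_le _ _ Hk)).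
  rewrite Hnk in B2.
  specialize (B2 ltac:(intros; apply lnsinc_d_derive; [assumption | lra]) HM).
  match type of B2 with Rabs ?u <= _ => set (E2 := u) in B2 end.
  set (e := fun j : nat => lnsinc_d 1 ((2 * INR j - 1) * k) + (2 * INR j - 1) * k / 3
                           + ((2 * INR j - 1) * k) ^ 3 / 45).
  assert (Hj : forall j, (1 <= j <= nu)%nat -> 0 < (2 * INR j - 1) * k <= 2 * INR nu * k).
  { intros j Hj; assert (J1 := le_INR 1 j ltac:(lia)); assert (J2 := le_INR j nu ltac:(lia)).
    simpl (INR 1) in J1; split; [apply Rmult_lt_0_compat | apply Rmult_le_compat_r]; lra. }
  assert (B3 : Rabs (sum_n_m e 1 nu) <= INR nu * (M * (2 * INR nu * k) ^ 5)).
  { apply sum_n_m_abs_le; intros j Hj'; specialize (Hj j Hj').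
    eapply Rle_trans; [apply (taylor_lnsinc M _ HM); lra|].
    apply Rmult_le_compat_l; [exact M0|]; apply pow_incr; lra. }
  assert (B4 := proj1 (taylor_lnsinc M (2 * INR nu * k) HM ltac:(split; [apply Rmult_le_pos|]; lra))).
  match type of B4 with Rabs ?u <= _ => set (E4 := u) in B4 end.
  assert (Hcot : sum_n_m (fun l => cotan (INR l * k)) 1 n =
    harmonic n / k + sum_n_m (fun l => lnsinc_d 1 (INR l * k)) 1 n :> R).
  { transitivity (sum_n_m (fun l => (/ k) * / INR l + 1 * lnsinc_d 1 (INR l * k)) 1 n).
    - apply sum_n_m_R_ext; intros l Hl.
      assert (L1 := lt_0_INR l ltac:(lia)); assert (L2 := le_INR l n ltac:(lia)).
      assert (L3 : INR l * k <= PI / 2) by (rewrite <- Hnk; apply Rmult_le_compat_r; lra).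
      rewrite cotan_lnsinc by (split; [apply Rmult_lt_0_compat|]; lra).
      field; lra.
    - rewrite (sum_n_m_lin (fun l => / INR l) (fun l => lnsinc_d 1 (INR l * k))).
      unfold harmonic; field; lra. }
  assert (Hodd : sum_n_m (fun j => cotan ((2 * INR j - 1) * k)) 1 nu =
    (harmonic (2 * nu) - harmonic nu / 2) / k - INR nu ^ 2 * k / 3
    - INR nu ^ 2 * (2 * INR nu ^ 2 - 1) * k ^ 3 / 45 + sum_n_m e 1 nu :> R).
  { rewrite <- odd_sums by exact Hk.
    transitivity (sum_n_m (fun j => 1 * (/ ((2 * INR j - 1) * k) - (2 * INR j - 1) * k / 3
                    - ((2 * INR j - 1) * k) ^ 3 / 45) + 1 * e j) 1 nu).
    - apply sum_n_m_R_ext; intros j Hj'; specialize (Hj j Hj').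
      rewrite cotan_lnsinc by lra; unfold e; ring.
    - rewrite (sum_n_m_lin (fun j => / ((2 * INR j - 1) * k) - (2 * INR j - 1) * k / 3
                    - ((2 * INR j - 1) * k) ^ 3 / 45) e); ring. }
  assert (Hln : ln (2 * sin (PI * INR nu / INR n))
    = ln 2 + (ln 2 + ln (INR nu) + ln k) + lnsinc_d 0 (2 * INR nu * k)).
  { replace (PI * INR nu / INR n) with (2 * INR nu * k) by (unfold k; field; lra).
    assert (H2 : 0 < 2 * INR nu * k) by (apply Rmult_lt_0_compat; lra).
    rewrite ln_mult by (try apply sin_gt_0; lra).
    rewrite ln_sin, !ln_mult by lra; ring. }
  assert (Hlnk : ln k = ln PI - (ln 2 + ln (INR n)))
    by (unfold k; rewrite ln_div, ln_mult by lra; reflexivity).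
  (* An exact identity: all logarithms, gamma, harmonic numbers and explicit powers of n cancel. *)
  assert (Hid : cosec_sum n nu - cosec_free_approx n nu
    = / k * E1 - / k * E2 - 2 * sum_n_m e 1 nu + / k * E4).
  { rewrite cosec_sum_cotan by lia; fold k; rewrite Hcot, Hodd.
    unfold cosec_free_approx, g, E1, E2, E4, harmonic_defect; rewrite Hln.
    destruct lnsinc_d_at_PI2 as (-> & -> & -> & ->).
    destruct lnsinc_d_at_0 as (-> & -> & -> & _ & -> & _).
    rewrite ln_div, Hlnk by lra.
    (* The regular sum occurs both in the cosecant sum and in [E2], and cancels as an opaque
       quantity. *)
    generalize (sum_n_m (fun l => lnsinc_d 1 (INR l * k)) 1 n); intros s.
    unfold k; field; lra. }
  rewrite Hid.
  assert (Hk' := Rinv_0_lt_compat k Hk).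
  apply Rabs_le_between in B1, B2, B3, B4.
  assert (C1 : / k * E1 <= / k * (240 / INR n ^ 5)) by (apply Rmult_le_compat_l; lra).
  assert (C1' : / k * - (240 / INR n ^ 5) <= / k * E1) by (apply Rmult_le_compat_l; lra).
  assert (C2 : / k * E2 <= / k * (INR n * (M * k ^ 6))) by (apply Rmult_le_compat_l; lra).
  assert (C2' : / k * - (INR n * (M * k ^ 6)) <= / k * E2) by (apply Rmult_le_compat_l; lra).
  assert (C4 : / k * E4 <= / k * (M * (2 * INR nu * k) ^ 6)) by (apply Rmult_le_compat_l; lra).
  assert (C4' : / k * - (M * (2 * INR nu * k) ^ 6) <= / k * E4) by (apply Rmult_le_compat_l; lra).
  rewrite <- Ropp_mult_distr_r in C1', C2', C4'.
  apply Rabs_le; split; lra.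
Qed.

Lemma cosec_sum_bigO (nu : nat) :
  (0 < nu)%nat ->
  exists C, forall n, (2 * nu <= n)%nat ->
  Rabs (cosec_sum n nu - cosec_free_approx n nu) <= C / INR n ^ 4.
Proof.
  intros Hnu; destruct lnsinc_d_6_bounded as [M HM].
  assert (HP := PI_RGT_0).
  assert (M0 : 0 <= M).
  { specialize (HM 0 ltac:(lra)); assert (H := Rabs_pos (lnsinc_d 6 0)); lra. }
  set (A := M * (2 * INR nu) ^ 5 * (PI / 2) ^ 5).
  assert (A0 : 0 <= A).
  { assert (Hv := pos_INR nu).
    apply Rmult_le_pos; [apply Rmult_le_pos; [exact M0|]|]; apply pow_le; lra. }
  (* Since 1/k = 2n/pi, the first two errors are of order n^-4. Each of the other two equals 2 nu
     A/n^5, which is relaxed to n^-4. *)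
  exists (480 / PI + M * (PI / 2) ^ 5 + (2 * INR nu + 2 * INR nu) * A).
  intros n Hn.
  eapply Rle_trans; [apply (cosec_sum_error M); assumption|]; cbv zeta.
  assert (Hn1 := le_INR 1 n ltac:(lia)); simpl (INR 1) in Hn1.
  assert (H5 : A / INR n ^ 5 <= A / INR n ^ 4).
  { apply Rmult_le_compat_l; [exact A0|]; apply Rinv_le_contravar; [apply pow_lt; lra|].
    apply Rle_pow; [lra | lia]. }
  assert (Hv := pos_INR nu).
  apply (Rmult_le_compat_l (2 * INR nu + 2 * INR nu)) in H5; [|lra].
  replace ((_ + _ + _) / INR n ^ 4) with
    (480 / PI / INR n ^ 4 + M * (PI / 2) ^ 5 / INR n ^ 4
     + (2 * INR nu + 2 * INR nu) * (A / INR n ^ 4)) by (field; lra).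
  match goal with |- ?u <= _ => replace u with
    (480 / PI / INR n ^ 4 + M * (PI / 2) ^ 5 / INR n ^ 4
     + (2 * INR nu + 2 * INR nu) * (A / INR n ^ 5)); [lra|unfold A; field; lra] end.
Qed.

(* [is_domin F f g] reads g = o(f) along the filter F. *)
Theorem theorem8 (nu : nat) (hnu : (1 < nu)%nat) :
  is_domin eventually
    (fun n : nat => / INR n ^ 3)
    (fun n : nat => cosec_sum n nu - cosec_free_approx n nu)
  /\ is_lim_seq (fun n : nat => cosec_sum n nu - cosec_free_approx n nu) 0.
Proof.
  destruct (cosec_sum_bigO nu ltac:(lia)) as [C HC].
  split.
  - intros eps.
    (* C/n^4 is split as (C/n) n^-3, whose first factor is eventually below eps. *)
    assert (L := is_lim_seq_inv_pow C 1 ltac:(lia)).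
    apply is_lim_seq_spec in L; destruct (L eps) as [N HN].
    exists (N + 2 * nu)%nat; intros n Hn.
    specialize (HC n ltac:(lia)); specialize (HN n ltac:(lia)).
    assert (Hn' := lt_0_INR n ltac:(lia)).
    assert (H3 : 0 < / INR n ^ 3) by (apply Rinv_0_lt_compat, pow_lt, Hn').
    change (Rabs (cosec_sum n nu - cosec_free_approx n nu) <= eps * Rabs (/ INR n ^ 3)).
    rewrite (Rabs_pos_eq (/ INR n ^ 3)) by lra.
    eapply Rle_trans; [exact HC|].
    replace (C / INR n ^ 4) with (C / INR n ^ 1 * / INR n ^ 3) by (field; lra).
    apply Rmult_le_compat_r; [lra|].
    rewrite Rminus_0_r in HN; apply Rabs_lt_between in HN; lra.
  - apply is_lim_seq_abs_0.
    apply (is_lim_seq_le_le_loc (fun _ => 0) _ (fun n => C / INR n ^ 4)).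
    + exists (2 * nu)%nat; intros n Hn; split; [apply Rabs_pos | apply HC, Hn].
    + apply is_lim_seq_const.
    + apply is_lim_seq_inv_pow; lia.
Qed.
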